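(* Fix an integer $n\ge 2$. Then, as $q$ ranges over prime powers, $$f(n,q)\le q^{2n-4}+2q^{2n-6}+2q^{2n-7}+3q^{2n-8}+3q^{2n-9}+3q^{2n-10}+3q^{2n-11}+O(q^{2n-12}),$$ where the implied constant in the $O(\cdot)$ term depends only on $n$.
   Context: $\mathrm{PG}(n,q)$ denotes the $n$-dimensional projective space over the finite field $\mathbb F_q$; a $d$-dimensional projective subspace is called a $d$-space (lines are $1$-spaces, planes are $2$-spaces). A $(2,1)$-blocking set in $\mathrm{PG}(n,q)$ is a set $\mathcal B$ of lines such that every plane of $\mathrm{PG}(n,q)$ contains at least one line of $\mathcal B$. For $n\ge -1$, $f(n,q)$ denotes the smallest possible size of a $(2,1)$-blocking set in $\mathrm{PG}(n,q)$ (so $f(-1,q)=f(0,q)=f(1,q)=0$, as there are no planes). *)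

(* Defs.v *)
From mathcomp Require Import all_boot all_order all_algebra.
Set Implicit Arguments. Unset Strict Implicit. Unset Printing Implicit Defensive.
Import GRing.Theory Num.Theory.
Local Open Scope ring_scope.

(* PG(n,q) over a finite field F: points are 1-dim subspaces of F^(n+1)
   (row vectors 'rV[F]_(n.+1)); a projective d-space is identified with the
   (d+1)-dimensional vector subspace, represented by its set of vectors. *)

Definition is_pspace (F : finFieldType) (n d : nat) (S : {set 'rV[F]_(n.+1)}) : bool :=
  [exists A : 'M[F]_(d.+1, n.+1),
     (\rank A == d.+1)%N && (S == [set v | (v <= A)%MS])].

Definition is_line (F : finFieldType) (n : nat) (S : {set 'rV[F]_(n.+1)}) : bool :=
  is_pspace 1 S.
Definition is_plane (F : finFieldType) (n : nat) (S : {set 'rV[F]_(n.+1)}) : bool :=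
  is_pspace 2 S.

Definition blocking21 (F : finFieldType) (n : nat)
    (B : {set {set 'rV[F]_(n.+1)}}) : bool :=
  [forall L in B, is_line L] &&
  [forall P : {set 'rV[F]_(n.+1)}, is_plane P ==>
     [exists L in B, L \subset P]].

Definition all_lines (F : finFieldType) (n : nat) : {set {set 'rV[F]_(n.+1)}} :=
  [set L | is_line L].

(* f(n,q): the smallest size of a (2,1)-blocking set of PG(n,F), where
   q = #|F|.  (The set of all lines is a (2,1)-blocking set, so the arg min
   is taken over a nonempty family.) *)
Definition f21 (F : finFieldType) (n : nat) : nat :=
  #|[arg min_(B < all_lines F n | blocking21 B) #|B| ]|.

(* Main.v *)
(* For n >= 3 write F^(n+1) = W + U with dim W = 4 and dim U = u = n - 3.
   Take all lines that project from U onto a line of a spread of PG(W): there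
   are q^(2u) (q^2 + 1) of them and they block the planes disjoint from U.
   For each point p of U choose a hyperplane H_p of W and take the lines that
   join p to a point projecting into H_p: there are [u] q^(u-1) (q^2 + q + 1),
   with [u] = (q^u - 1) / (q - 1), and they block the planes meeting U in a point.  If p |-> H_p is
   induced by a linear map U -> W^* with kernel K, then for a line m of U
   disjoint from K the planes H_p with p on m form a pencil covering W, so the
   planes meeting U in m are blocked too.  The lines of U meeting K, and enough
   lines of U to block the planes inside U, add only O(q^(2n-12)) lines. *)

Require Import Defs.
From mathcomp Require Import all_boot all_order all_algebra.
From mathcomp Require Import mxabelem ring lra zify.
Import Order.TTheory GRing.Theory Num.Theory.
Local Open Scope ring_scope.

(** The fibre of [f] through [d] contains every [act g d] with [g] in [H], and these are [#|H|]
    distinct elements; summing over the fibres gives the bound. *)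
Lemma leq_card_imset_fibers (G T R : finType) (H : {set G}) (D : {set T})
    (f : T -> R) (act : G -> T -> T) :
  (forall g d, g \in H -> d \in D -> act g d \in D /\ f (act g d) = f d) ->
  (forall d, d \in D -> {in H &, injective (act^~ d)}) ->
  (#|f @: D| * #|H| <= #|D|)%N.
Proof.
move=> stab inj; rewrite -(sum1_card (mem D)).
rewrite (partition_big_imset f) /= -sum_nat_const.
apply: leq_sum => _ /imsetP[d dD ->]; rewrite sum1dep_card.
rewrite -(card_in_imset (inj d dD)); apply/subset_leq_card/subsetP=> _ /imsetP[g gH ->].
by have [gdD fgd] := stab g d gH dD; rewrite inE gdD fgd eqxx.
Qed.

(** * Independent pairs of vectors and the lines they span *)

Section Independence.
Variables (F : fieldType) (N : nat).
Implicit Types v w x : 'rV[F]_N.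

Definition indep v w := (v != 0) && ~~ (w <= v)%MS.

Lemma sub_col_mxl v w : (v <= col_mx v w)%MS.
Proof. by rewrite -addsmxE addsmxSl. Qed.

Lemma sub_col_mxr v w : (w <= col_mx v w)%MS.
Proof. by rewrite -addsmxE addsmxSr. Qed.

Lemma sub_col_mx_comb v w a b : ((a *: v + b *: w)%R <= col_mx v w)%MS.
Proof. by rewrite addmx_sub // scalemx_sub // (sub_col_mxl, sub_col_mxr). Qed.

Lemma rank_indep v w : indep v w -> \rank (col_mx v w) = 2.
Proof.
case/andP=> v0 wv; apply/eqP; rewrite eqn_leq rank_leq_row /=.
have [+ E] := mxrank_leqif_sup (sub_col_mxl v w).
rewrite rank_rV v0 leq_eqVlt => /orP[|//]; rewrite /nat_of_bool.
move: E; rewrite rank_rV v0 => ->.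
by rewrite -addsmxE addsmx_sub (negPf wv) andbF.
Qed.

Lemma indepP v w :
  reflect (forall a b, a *: v + b *: w = 0 -> a = 0 /\ b = 0) (indep v w).
Proof.
apply: (iffP andP) => [[v0 wv] a b E | E].
  have b0 : b = 0.
    apply/eqP/negPn/negP=> b0; case/negP: wv; apply/sub_rVP; exists (- a / b).
    apply: (scalerI b0); rewrite scalerA mulrC divfK // scaleNr.
    by apply/eqP; rewrite -addr_eq0 addrC E.
  split=> //; move/eqP: E; rewrite b0 scale0r addr0 scaler_eq0 (negPf v0) orbF.
  by move/eqP.
split.
  apply/eqP=> v0; have [|/eqP] := E 1 0; first by rewrite v0 scale0r addr0 scaler0.
  by rewrite oner_eq0.
apply/sub_rVP=> -[a wE]; have [|_ /eqP] := E (- a) 1.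
  by rewrite wE scale1r scaleNr addNr.
by rewrite oner_eq0.
Qed.

End Independence.
Arguments indep {F N}.
Arguments indepP {F N v w}.
Arguments sub_col_mxl {F N}.
Arguments sub_col_mxr {F N}.
Arguments sub_col_mx_comb {F N}.
Arguments rank_indep {F N v w}.

Section Lines.
Variables (F : finFieldType) (N : nat).
Implicit Types v w x : 'rV[F]_N.

Definition lspan v w : {set 'rV[F]_N} := [set x | (x <= col_mx v w)%MS].

Lemma lspan_eq v w v' w' : indep v w -> indep v' w' ->
  (v' <= col_mx v w)%MS -> (w' <= col_mx v w)%MS -> lspan v' w' = lspan v w.
Proof.
move=> i1 i2 s1 s2.
have s : (col_mx v' w' <= col_mx v w)%MS by rewrite -addsmxE addsmx_sub s1.
have E : (col_mx v w <= col_mx v' w')%MS.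
  by have [_ <-] := mxrank_leqif_sup s; rewrite !rank_indep.
apply/setP=> x; rewrite !inE; apply/idP/idP=> H; exact: (submx_trans H).
Qed.

(** The substitutions with [a] and [b] nonzero and [c] arbitrary are the changes of basis that fix
    the line and the point spanned by the first vector. There are [(q - 1)^2 q] of them, so each
    line is produced by at least that many pairs of [D]. *)
Lemma card_lspan_flags (D : {set 'rV[F]_N * 'rV[F]_N}) :
  (forall d, d \in D -> indep d.1 d.2) ->
  (forall d a b c, d \in D -> a != 0 -> b != 0 ->
     (a *: d.1, b *: d.2 + c *: d.1) \in D) ->
  (#|[set lspan d.1 d.2 | d in D]| * (#|F|.-1 ^ 2 * #|F|) <= #|D|)%N.
Proof.
move=> Di Dst.
pose H : {set F * F * F} := setX (setX [set~ 0] [set~ 0]) setT.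
have <- : #|H| = (#|F|.-1 ^ 2 * #|F|)%N.
  by rewrite !cardsX cardsT cardsC1 mulnn.
apply: (@leq_card_imset_fibers _ _ _ _ _ _
  (fun g d => (g.1.1 *: d.1, g.1.2 *: d.2 + g.2 *: d.1))).
  move=> [[a b] c] d; rewrite !inE /= andbT => /andP[a0 b0] dD.
  have d'D := Dst d a b c dD a0 b0; split=> //; apply: lspan_eq.
  - exact: Di.
  - exact: Di _ d'D.
  - by rewrite scalemx_sub ?sub_col_mxl.
  - by rewrite addrC sub_col_mx_comb.
move=> d /Di i [[a b] c] [[a' b'] c'] _ _ /= [E1 E2].
have ind := indepP i.
have d0 : d.1 != 0 by case/andP: i.
have aE : a = a'.
  apply/eqP; rewrite -subr_eq0; have [|-> //] := ind (a - a') 0.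
  by rewrite scalerBl E1 subrr scale0r addr0.
have [|/eqP + /eqP] := ind (c - c') (b - b').
  transitivity (b *: d.2 + c *: d.1 - (b' *: d.2 + c' *: d.1)).
    by rewrite addrC !scalerBl opprD [RHS]addrACA.
  by rewrite E2 subrr.
by rewrite !subr_eq0 => /eqP-> /eqP->; rewrite aE.
Qed.

End Lines.
Arguments lspan {F N}.
Arguments lspan_eq {F N v w v' w'}.
Arguments card_lspan_flags {F N}.

Lemma f21_le (F : finFieldType) (n : nat) (B : {set {set 'rV[F]_n.+1}}) :
  (forall L, L \in B -> exists v w, indep v w /\ L = lspan v w) ->
  (forall A : 'M[F]_(3, n.+1), \rank A = 3 ->
     exists v w, [/\ (v <= A)%MS, (w <= A)%MS & lspan v w \in B]) ->
  (f21 F n <= #|B|)%N.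
Proof.
move=> Bl Bb; have line_lspan v w : indep v w -> is_line (lspan v w).
  by move=> i; apply/existsP; exists (col_mx v w); rewrite rank_indep //= eqxx.
have line_B L : L \in B -> is_line L by move/Bl=> [v [w [i ->]]]; apply: line_lspan.
have blockB : blocking21 B.
  apply/andP; split; first by apply/forall_inP.
  apply/forall_inP=> P /existsP[A /andP[/eqP rA /eqP ->]].
  have [v [w [vA wA LB]]] := Bb A rA; apply/exists_inP; exists (lspan v w) => //.
  apply/subsetP=> x; rewrite !inE => /submx_trans; apply.
  by rewrite -addsmxE addsmx_sub vA.
rewrite /f21; case: arg_minnP => [|C _ /(_ B blockB) //].
(* The default set of the [arg min] must itself be blocking: [all_lines] is, because it contains
   [B]. *)
case/andP: blockB => _ /forall_inP Bp; apply/andP; split.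
  by apply/forall_inP=> L; rewrite inE.
apply/forall_inP=> P /Bp /exists_inP[L LB LP]; apply/exists_inP; exists L => //.
by rewrite inE line_B.
Qed.

(** * Vectors found by rank comparison, and sizes of kernels *)

Lemma exists_row_notin (F : fieldType) (m1 m2 n : nat)
    (A : 'M[F]_(m1, n)) (B : 'M[F]_(m2, n)) :
  (\rank B < \rank A)%N -> exists v : 'rV_n, (v <= A)%MS && ~~ (v <= B)%MS.
Proof.
move=> lt; have /row_subPn[i Bi] : ~~ (A <= B)%MS.
  by apply: contraL lt => /mxrankS; rewrite -leqNgt.
by exists (row i A); rewrite row_sub.
Qed.

Lemma exists_row_neq0 (F : fieldType) (m n : nat) (A : 'M[F]_(m, n)) :
  (0 < \rank A)%N -> exists2 v : 'rV_n, (v <= A)%MS & v != 0.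
Proof. by rewrite lt0n mxrank_eq0 => /rowV0Pn[v vA v0]; exists v. Qed.

Lemma exists_ker_row (F : fieldType) (m n : nat) (A : 'M[F]_(m, n)) :
  (\rank A < m)%N -> exists2 x : 'rV_m, x != 0 & x *m A = 0.
Proof.
rewrite -subn_gt0 -mxrank_ker => /exists_row_neq0[x /sub_kermxP xA x0].
by exists x.
Qed.

Lemma card_ker_rows (F : finFieldType) (m n : nat) (A : 'M[F]_(m, n)) :
  #|[set x : 'rV_m | x *m A == 0]| = (#|F| ^ (m - \rank A))%N.
Proof.
by rewrite -mxrank_ker -card_rowg; apply: eq_card => x; rewrite !inE sub_kermx.
Qed.

(** * A line spread of projective 3-space from an irreducible quadratic *)

Lemma exists_irreducible_quadratic (F : finFieldType) :
  exists c : F, forall x : F, x ^+ 2 - x != c.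
Proof.
pose g (x : F) := x ^+ 2 - x.
have [/forallP im_g | /forallPn[c /codomP cg]] := boolP [forall c, c \in codom g].
  have /image_injP g_inj : #|image g F| == #|F|.
    by apply/eqP/eq_card => c; rewrite im_g.
  (* On a finite field a surjective [g] would be injective, but [g] agrees at 0 and 1. Unlike
     squaring, [x ^+ 2 - x] fails to be injective in characteristic 2 as well. *)
  have E : g 0 = g 1 by rewrite /g expr0n expr1n !subrr.
  by have /eqP := g_inj 0 1 isT isT E; rewrite eq_sym oner_eq0.
by exists c => x; apply/eqP=> E; apply: cg; exists x.
Qed.

(* This matrix satisfies [S ^ 2 = S + c]; if [X ^ 2 - X - c] has no root, the lines
   spanned by [z] and [z *m S] form a spread of the projective 3-space. *)
Definition companion {F : fieldType} (c : F) : 'M[F]_(2 + 2) :=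
  block_mx 0 1%:M c%:M 1%:M.

Arguments exists_row_neq0 {F m n A}.

Section Companion.
Variables (F : fieldType) (c : F).
Hypothesis irr : forall x : F, x ^+ 2 - x != c.
Local Notation S := (companion c).

Lemma companion_sqr : S *m S = S + c%:M.
Proof.
rewrite /companion mulmx_block !mul0mx !mul1mx !mulmx1 mulmx0 !add0r.
by rewrite (@scalar_mx_block _ 2 2) add_block_mx !addr0 add0r [c%:M + _]addrC.
Qed.

(** If [z *m S] were [a *: z], then [companion_sqr] would make [a] a root of [X^2 - X - c]. *)
Lemma companion_free (z : 'rV_4) : z != 0 -> indep z (z *m S).
Proof.
move=> z0; rewrite /indep z0; apply/sub_rVP => -[a zE].
have /eqP : (a ^+ 2 - a - c) *: z = 0.
  have : z *m (S *m S) = z *m (S + c%:M) by rewrite companion_sqr.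
  rewrite mulmxA zE -scalemxAl zE mulmxDr zE mul_mx_scalar scalerA.
  by rewrite !scalerBl expr2 => ->; rewrite [a *: z + _]addrC addrK subrr.
by rewrite scaler_eq0 (negPf z0) orbF subr_eq0 (negPf (irr a)).
Qed.

End Companion.
Arguments companion_free {F c} irr {z}.

(** * The blocking set: its lines, their number and the blocking property *)

Section Construction.
Variables (F : finFieldType) (c : F) (u : nat).
Hypothesis irr : forall x : F, x ^+ 2 - x != c.
Local Notation S := (companion c).
(* [lsubmx] is the projection onto [W] and its kernel is [U]. *)
Local Notation V := 'rV[F]_(4 + u).
Local Notation q := #|F|.

Definition spread_pairs : {set V * V} :=
  [set d | (lsubmx d.1 != 0) && (lsubmx d.2 == lsubmx d.1 *m S)].

Definition spread_lines := [set lspan d.1 d.2 | d in spread_pairs].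

Lemma lsubmx_comb (a b : F) (v w : V) :
  lsubmx (a *: v + b *: w) = a *: lsubmx v + b *: lsubmx w.
Proof. by rewrite linearD !linearZ. Qed.

Lemma indep_spread_pairs d : d \in spread_pairs -> indep d.1 d.2.
Proof.
rewrite inE => /andP[v0 /eqP wE]; apply/indepP=> a b E.
apply/(indepP (companion_free irr v0)).
by rewrite -wE -lsubmx_comb E linear0.
Qed.

Lemma card_spread_pairs : (#|spread_pairs| <= (q ^ 4).-1 * q ^ u * q ^ u)%N.
Proof.
pose f (t : 'rV[F]_4 * 'rV[F]_u * 'rV[F]_u) : V * V :=
  (row_mx t.1.1 t.1.2, row_mx (t.1.1 *m S) t.2).
have sub : spread_pairs \subset f @: setX (setX [set~ 0] setT) setT.
  apply/subsetP=> -[v w]; rewrite inE /= => /andP[v0 /eqP wE].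
  apply/imsetP; exists (lsubmx v, rsubmx v, rsubmx w); first by rewrite !inE v0.
  by rewrite /f /= -wE !hsubmxK.
apply: leq_trans (subset_leq_card sub) (leq_trans (leq_imset_card _ _) _).
by rewrite !cardsX !cardsT cardsC1 !card_mx !mul1n.
Qed.

(** A nonzero [g] acts as multiplication by [g.1 + g.2 S], where [S] sends [d.1] to [d.2] and [d.2]
    to [d.2 + c *: d.1], as [companion_sqr] dictates. So each line has at least [q^2 - 1] bases in
    [spread_pairs]. *)
Lemma card_spread_lines : (#|spread_lines| * (q ^ 2).-1 <= (q ^ 4).-1 * q ^ u * q ^ u)%N.
Proof.
apply: leq_trans card_spread_pairs.
have <- : #|[set~ (0, 0) : F * F]| = (q ^ 2).-1 by rewrite cardsC1 card_prod mulnn.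
pose act (g : F * F) (d : V * V) := (g.1 *: d.1 + g.2 *: d.2,
  g.1 *: d.2 + g.2 *: (d.2 + c *: d.1)).
apply: (@leq_card_imset_fibers _ _ _ _ _ _ act) => [g d|d dD].
  rewrite in_setC1 => g0 dD; have := dD; rewrite inE => /andP[v0 /eqP wE].
  have i := companion_free irr v0.
  have z0 : g.1 *: lsubmx d.1 + g.2 *: (lsubmx d.1 *m S) != 0.
    apply: contra g0 => /eqP /(indepP i)[g1 g2].
    by rewrite [g]surjective_pairing g1 g2.
  have d'D : act g d \in spread_pairs.
    rewrite inE /= !lsubmx_comb wE z0 /=; apply/eqP.
    rewrite linearD linearZ /= wE mulmxDl -!scalemxAl -mulmxA companion_sqr.
    by rewrite mulmxDr mul_mx_scalar.
  split=> //; apply: lspan_eq.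
  - exact: indep_spread_pairs.
  - exact: indep_spread_pairs.
  - exact: sub_col_mx_comb.
  - have -> : (act g d).2 = (g.2 * c) *: d.1 + (g.1 + g.2) *: d.2.
      by rewrite /= scalerDr scalerA scalerDl addrA addrC.
    exact: sub_col_mx_comb.
move=> g h _ _ /= [E _].
have [|/eqP + /eqP] := indepP (indep_spread_pairs _ dD) (g.1 - h.1) (g.2 - h.2).
  by rewrite !scalerBl addrACA -opprD E subrr.
rewrite !subr_eq0 => /eqP e1 /eqP e2.
by rewrite [g]surjective_pairing e1 e2 -surjective_pairing.
Qed.

(** Keeps the first [j] coordinates of [p]. The map [proj4 4] is the linear map from U to the dual
    of W, a row of length 4 being read as the coefficients of a linear form. *)
Definition proj4 j (p : 'rV[F]_u) : 'rV[F]_4 := p *m pid_mx j.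

(* The fallback value only has to be nonzero, so that its kernel is a hyperplane. *)
Definition gauge (p : 'rV[F]_u) : 'rV[F]_4 :=
  if proj4 4 p == 0 then const_mx 1 else proj4 4 p.

(* The case [lsubmx d.2 == 0] describes lines inside [U]: those through a point of
   the kernel of [proj4 4], and lines of [U] of a kind found in every plane of [U],
   since the kernels of [proj4 2] and [proj4 1] have codimension 2 and 1. *)
Definition flag_pairs : {set V * V} := [set d : V * V |
  [&& lsubmx d.1 == 0, indep d.1 d.2 &
      if lsubmx d.2 == 0 then (proj4 4 (rsubmx d.1) == 0) ||
        (proj4 2 (rsubmx d.1) == 0) && (proj4 1 (rsubmx d.2) == 0)
      else lsubmx d.2 *m (gauge (rsubmx d.1))^T == 0]].

Definition flag_lines := [set lspan d.1 d.2 | d in flag_pairs].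

Lemma gauge_neq0 p : gauge p != 0.
Proof.
rewrite /gauge; case: ifPn => // _; apply/eqP=> /rowP/(_ 0)/eqP.
by rewrite !mxE oner_eq0.
Qed.

Lemma rank_proj4 j : (j <= 4)%N -> \rank (pid_mx j : 'M[F]_(u, 4)) = minn u j.
Proof.
by move=> j4; rewrite -pid_mx_minv rank_pid_mx ?geq_minl // geq_min j4 orbT.
Qed.

Lemma proj4_sub p : proj4 2 p = 0 -> proj4 1 p = 0.
Proof.
move=> p2; rewrite /proj4.
have -> : pid_mx 1 = (pid_mx 2 : 'M[F]_(u, 4)) *m (pid_mx 1 : 'M_4).
  by rewrite mul_pid_mx.
by rewrite mulmxA -/(proj4 2 p) p2 mul0mx.
Qed.

Lemma flag_pairs_stable d a b e : d \in flag_pairs -> a != 0 -> b != 0 ->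
  (a *: d.1, b *: d.2 + e *: d.1) \in flag_pairs.
Proof.
case: d => x y; rewrite !inE /= => /and3P[/eqP x0 i Q] a0 b0.
have i' : indep (a *: x) (b *: y + e *: x).
  apply/indepP=> r s; rewrite scalerA scalerDr !scalerA addrCA -scalerDl addrC.
  case/(indepP i)=> /eqP; rewrite addrC.
  move=> E /eqP; rewrite mulf_eq0 (negPf b0) orbF => /eqP s0; split=> //.
  by move: E; rewrite s0 mul0r add0r mulf_eq0 (negPf a0) orbF => /eqP.
have lx : lsubmx (a *: x) = 0 by rewrite linearZ /= x0 scaler0.
have ly : lsubmx (b *: y + e *: x) = b *: lsubmx y.
  by rewrite lsubmx_comb x0 scaler0 addr0.
rewrite i' lx ly eqxx /=.
rewrite scaler_eq0 (negPf b0) /=; case: ifP Q => _ Q.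
  rewrite /proj4 linearD !linearZ /= -!scalemxAl mulmxDl -!scalemxAl !scaler_eq0.
  rewrite (negPf a0) /=; case/orP: Q => [-> //|/andP[/[dup] /eqP/proj4_sub]].
  rewrite /proj4 => -> -> /eqP->.
  by rewrite !scaler0 addr0 eqxx orbT.
(* Because of its fallback value [gauge] is not linear, but rescaling the point changes it at most
   by a nonzero scalar, which preserves the hyperplane. *)
have E : gauge (rsubmx (a *: x)) = gauge (rsubmx x) \/
    gauge (rsubmx (a *: x)) = a *: gauge (rsubmx x).
  rewrite /gauge /proj4 linearZ /= -scalemxAl scaler_eq0 (negPf a0) /=.
  by case: ifP; [left | right].
by case: E => ->; rewrite -?scalemxAl ?linearZ /= -?scalemxAr (eqP Q) !scaler0.
Qed.

Lemma card_proj4_ker j : (j <= 4)%N ->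
  #|[set p | proj4 j p == 0]| = (q ^ (u - j))%N.
Proof.
by move=> j4; rewrite card_ker_rows rank_proj4 //; congr (_ ^ _)%N; lia.
Qed.

Lemma card_proj4_ker_neq0 j : (j <= 4)%N ->
  #|[set p | (p != 0) && (proj4 j p == 0)]| = (q ^ (u - j)).-1.
Proof.
move=> j4; rewrite -card_proj4_ker // [X in _ = X.-1](cardsD1 0) inE.
rewrite /proj4 mul0mx eqxx; apply: eq_card => p; by rewrite !inE.
Qed.

(** The three terms count the three cases of [flag_pairs]. In the first, choose a nonzero vector of
    U, a nonzero vector of its hyperplane in W, and a free U-component. In the other two both
    vectors lie in U, the first nonzero in the kernel of [proj4 4] or [proj4 2]. *)
Lemma card_flag_pairs : (#|flag_pairs| <= (q ^ u).-1 * (q ^ 3).-1 * q ^ u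
  + (q ^ (u - 4)).-1 * q ^ u + (q ^ (u - 2)).-1 * q ^ (u - 1))%N.
Proof.
pose f (t : 'rV[F]_u * 'rV[F]_4 * 'rV[F]_u) : V * V :=
  (row_mx 0 t.1.1, row_mx t.1.2 t.2).
pose h (t : 'rV[F]_u * 'rV[F]_u) := f (t.1, 0, t.2).
pose N j := [set p | (p != 0) && (proj4 j p == 0)].
pose M := [set t : 'rV[F]_u * 'rV[F]_4 |
  (t.1 != 0) && ((t.2 != 0) && (t.2 *m (gauge t.1)^T == 0))].
have cM : #|M| = ((q ^ u).-1 * (q ^ 3).-1)%N.
  rewrite -sum1dep_card -(pair_big_dep (fun p => p != 0)
    (fun p z => (z != 0) && (z *m (gauge p)^T == 0)) (fun _ _ => 1%N)) /=.
  transitivity (\sum_(p : 'rV[F]_u | (p != 0)%R) (q ^ 3).-1)%N.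
    apply: eq_bigr => p _; rewrite sum1dep_card.
    have -> : (q ^ 3)%N = #|[set z : 'rV_4 | z *m (gauge p)^T == 0]|.
      by rewrite card_ker_rows mxrank_tr rank_rV gauge_neq0.
    rewrite [X in _ = X.-1](cardsD1 0) inE mul0mx eqxx.
    by apply: eq_card => z; rewrite !inE.
  rewrite sum_nat_const; congr (_ * _)%N.
  transitivity #|[set~ (0 : 'rV[F]_u)]|; last by rewrite cardsC1 card_mx mul1n.
  by apply: eq_card => p; rewrite !inE.
have sub : flag_pairs \subset f @: setX M setT :|: h @: setX (N 4) setT
    :|: h @: setX (N 2) [set p | proj4 1 p == 0].
  apply/subsetP=> -[x y]; rewrite inE /= => /and3P[/eqP x0 /andP[xn0 _] Q].
  have xE : x = row_mx 0 (rsubmx x) by rewrite -x0 hsubmxK.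
  have r0 : rsubmx x != 0.
    by apply: contra xn0 => /eqP r0; rewrite xE r0 row_mx0.
  rewrite !inE; case: ifP Q => [/eqP y0 | y0 Q].
    have yE : y = row_mx 0 (rsubmx y) by rewrite -y0 hsubmxK.
    have hE : (x, y) = h (rsubmx x, rsubmx y) by rewrite /h /f /= -xE -yE.
    case/orP=> [Q|/andP[Q1 Q2]]; apply/orP; [left; apply/orP|]; right;
    by rewrite hE; apply: imset_f; rewrite !inE /= r0 /= ?Q ?Q1.
  apply/orP; left; apply/orP; left; apply/imsetP.
  exists (rsubmx x, lsubmx y, rsubmx y); first by rewrite !inE /= r0 y0 Q.
  by rewrite /f /= hsubmxK -xE.
apply: leq_trans (subset_leq_card sub) _.
apply: leq_trans (leq_card_setU _ _) (leq_add _ _); last first.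
  by apply: leq_trans (leq_imset_card _ _) _; rewrite cardsX card_proj4_ker_neq0 // card_proj4_ker.
apply: leq_trans (leq_card_setU _ _) (leq_add _ _);
  apply: leq_trans (leq_imset_card _ _) _.
  by rewrite cardsX cM cardsT card_mx mul1n.
by rewrite cardsX card_proj4_ker_neq0 // cardsT card_mx mul1n.
Qed.

Lemma card_flag_lines : (#|flag_lines| * (q.-1 ^ 2 * q) <=
  (q ^ u).-1 * (q ^ 3).-1 * q ^ u
  + (q ^ (u - 4)).-1 * q ^ u + (q ^ (u - 2)).-1 * q ^ (u - 1))%N.
Proof.
apply: leq_trans card_flag_pairs; apply: card_lspan_flags => [d|].
  by rewrite inE => /and3P[].
exact: flag_pairs_stable.
Qed.

Lemma mem_flag_lines (x y : V) : (x, y) \in flag_pairs -> lspan x y \in flag_lines.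
Proof. by move=> xy; apply/imsetP; exists (x, y). Qed.

(** The kernel of [lsubmx A] describes the intersection of the plane with U, so the ranks 3, 2, 1, 0
    correspond to an empty intersection, a point, a line, and a plane inside U. *)
Lemma spread_flag_lines_block (A : 'M[F]_(3, 4 + u)) : \rank A = 3 ->
  exists v w, [/\ (v <= A)%MS, (w <= A)%MS & lspan v w \in spread_lines :|: flag_lines].
Proof.
move=> rA; have Afree : row_free A by rewrite /row_free rA.
have lE (x : 'rV_3) : lsubmx (x *m A) = x *m lsubmx A by rewrite mulmx_lsub.
have rE (x : 'rV_3) : rsubmx (x *m A) = x *m rsubmx A by rewrite mulmx_rsub.
have A0 (x : 'rV_3) : x != 0 -> x *m A != 0.
  by apply: contra => /eqP xA; apply/eqP/(row_free_inj Afree); rewrite xA mul0mx.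
suff [x [y]] : exists x y : 'rV_3, ((x *m A, y *m A) \in spread_pairs) ||
    ((x *m A, y *m A) \in flag_pairs).
  move=> xy; exists (x *m A), (y *m A); rewrite !submxMl inE; split=> //.
  by case/orP: xy => [xy|/mem_flag_lines ->]; rewrite ?orbT //;
    apply/orP; left; apply/imsetP; exists (x *m A, y *m A).
have ind1 (x y : 'rV_3) : x != 0 -> ~~ (y <= x)%MS -> indep (x *m A) (y *m A).
  by move=> x0 xy; rewrite /indep A0 // submxMfree.
have ind2 (x y : 'rV_3) : x != 0 -> x *m lsubmx A = 0 -> y *m lsubmx A != 0 ->
    indep (x *m A) (y *m A).
  move=> x0 xA yA; apply: ind1 => //; apply: contra yA => /sub_rVP[a ->].
  by rewrite -scalemxAl xA scaler0.
have rk1 n (B : 'M[F]_(n, 1)) : (\rank B <= 1)%N := rank_leq_col B.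
have [lt2 | le2] := ltnP 2 (\rank (lsubmx A)).
  have lfree : row_free (lsubmx A) by rewrite /row_free eqn_leq rank_leq_row lt2.
  (* The plane projects onto a hyperplane of W. Applying [S] and reducing modulo this hyperplane has
     rank at most 1, so some nonzero [x] has its image under [S] back in it. *)
  have [|x x0 xE] := @exists_ker_row _ _ _ (lsubmx A *m S *m cokermx (lsubmx A)).
    apply: leq_ltn_trans (mxrankM_maxr _ _) _.
    by rewrite mxrank_coker (eqP lfree).
  have /submxP[y yE] : (x *m lsubmx A *m S <= lsubmx A)%MS.
    by rewrite submxE -!mulmxA -xE !mulmxA.
  exists x, y; apply/orP; left; rewrite inE /= !lE -yE eqxx andbT.
  by apply: contra x0 => /eqP xA; apply/eqP/(row_free_inj lfree); rewrite xA mul0mx.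
have [lt1 | le1] := ltnP 1 (\rank (lsubmx A)).
  have [|x x0 xE] := @exists_ker_row _ _ _ (lsubmx A); first exact: leq_ltn_trans le2 _.
  (* The gauge condition is one linear equation, so its solutions have dimension at least 2, whereas
     only dimension 1 projects to zero. *)
  have [|y /andP[/sub_kermxP yE]] := @exists_row_notin _ _ _ _
      (kermx (lsubmx A *m (gauge (x *m rsubmx A))^T)) (kermx (lsubmx A)).
    by rewrite !mxrank_ker; have := rk1 _ (lsubmx A *m (gauge (x *m rsubmx A))^T); lia.
  rewrite sub_kermx => yA; exists x, y; apply/orP; right.
  by rewrite inE /= !lE !rE xE eqxx ind2 //= (negPf yA) -mulmxA yE.
have [lt0 | le0] := ltnP 0 (\rank (lsubmx A)).
  have [z0 /submxP[z ->] zA] := exists_row_neq0 lt0.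
  (* Membership of the projected point [z] in the hyperplane of [x] is linear in [x], so it holds
     for some point of the line where the plane meets U. If that point lies in the kernel of
     [proj4 4], the line inside U is used instead. *)
  pose B := rsubmx A *m pid_mx 4 *m (z *m lsubmx A)^T.
  have [|x] := @exists_row_neq0 _ _ _ (kermx (lsubmx A) :&: kermx B)%MS.
    have := mxrank_sum_cap (kermx (lsubmx A)) (kermx B).
    have := rank_leq_row (kermx (lsubmx A) + kermx B)%MS.
    by rewrite !mxrank_ker; have := rk1 _ B; lia.
  rewrite sub_capmx => /andP[/sub_kermxP xE /sub_kermxP xB] x0.
  have [p0 | pn0] := eqVneq (proj4 4 (x *m rsubmx A)) 0.
    have [|y /andP[/sub_kermxP yE yx]] := @exists_row_notin _ _ _ _ (kermx (lsubmx A)) x.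
      by rewrite mxrank_ker rank_rV x0; lia.
    exists x, y; apply/orP; right.
    by rewrite inE /= !lE !rE xE yE p0 !eqxx ind1.
  exists x, z; apply/orP; right.
  rewrite inE /= !lE !rE xE eqxx ind2 //= (negPf zA) /gauge (negPf pn0).
  by apply/eqP/trmx_inj; rewrite trmx_mul trmxK trmx0 /proj4 -xB /B !mulmxA.
have lA : lsubmx A = 0 by apply/eqP; rewrite -mxrank_eq0 -leqn0.
have rk j : (j <= 4)%N -> (\rank (rsubmx A *m (pid_mx j : 'M_(u, 4))) <= j)%N.
  move=> j4; apply: leq_trans (mxrankM_maxr _ _) _.
  by rewrite rank_proj4 // geq_minr.
(* Inside a 3-dimensional space two equations leave a nonzero [x], and one equation leaves room for
   a [y] outside its span. *)
have [|x x0 xE] := @exists_ker_row _ _ _ (rsubmx A *m (pid_mx 2 : 'M_(u, 4))).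
  exact: leq_ltn_trans (rk 2 isT) _.
have [|y /andP[/sub_kermxP yE yx]] := @exists_row_notin _ _ _ _
    (kermx (rsubmx A *m (pid_mx 1 : 'M_(u, 4)))) x.
  by rewrite mxrank_ker rank_rV x0 ltn_subRL addn1 !ltnS (rk 1).
exists x, y; apply/orP; right.
rewrite inE /= !lE !rE lA !mulmx0 eqxx ind1 //= /proj4 -!mulmxA xE yE eqxx.
by rewrite orbT.
Qed.
End Construction.

(** * The case of a single plane and the numerical bounds *)

Lemma f21_plane (F : finFieldType) : (f21 F 2 <= 1)%N.
Proof.
pose v : 'rV[F]_3 := delta_mx 0 0; pose w : 'rV[F]_3 := delta_mx 0 1.
have i : indep v w.
  apply/indepP=> a b /rowP E; split.
    by have := E 0; rewrite !mxE /= mulr1 mulr0 addr0.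
  by have := E 1; rewrite !mxE /= mulr1 mulr0 add0r.
apply: (leq_trans _ (eq_leq (cards1 (lspan v w)))); apply: f21_le => [L|A rA].
  by rewrite inE => /eqP->; exists v, w.
have A1 (x : 'rV_3) : (x <= A)%MS by rewrite submx_full // /row_full rA.
by exists v, w; rewrite inE eqxx !A1.
Qed.

Lemma f21_construction (F : finFieldType) (u : nat) :
  exists a b : nat, [/\ (f21 F u.+3 <= a + b)%N,
    (a * (#|F| ^ 2).-1 <= (#|F| ^ 4).-1 * #|F| ^ u * #|F| ^ u)%N &
    (b * (#|F|.-1 ^ 2 * #|F|) <= (#|F| ^ u).-1 * (#|F| ^ 3).-1 * #|F| ^ u
      + (#|F| ^ (u - 4)).-1 * #|F| ^ u + (#|F| ^ (u - 2)).-1 * #|F| ^ (u - 1))%N].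
Proof.
have [c irr] := exists_irreducible_quadratic F.
exists #|spread_lines F c u|, #|flag_lines F u|; split.
- apply: leq_trans (leq_card_setU _ _).
  apply: f21_le => [L|A rA]; last exact: (spread_flag_lines_block F c u A rA).
  rewrite inE => /orP[] /imsetP[[v w] vw ->]; exists v, w; split=> //.
    exact: (indep_spread_pairs F c u irr _ vw).
  by move: vw; rewrite inE => /and3P[].
- exact: card_spread_lines.
- exact: card_flag_lines.
Qed.

Lemma construction_bound (q a b : rat) (u : nat) : 2 <= q ->
  a * (q ^+ 2 - 1) <= (q ^+ 4 - 1) * q ^+ u * q ^+ u ->
  b * ((q - 1) ^+ 2 * q) <= (q ^+ u - 1) * (q ^+ 3 - 1) * q ^+ u
    + (q ^+ (u - 4) - 1) * q ^+ u + (q ^+ (u - 2) - 1) * q ^+ (u - 1) ->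
  a + b <= q ^ (2 * u%:Z - 6) *
    (q ^+ 8 + 2 * q ^+ 6 + 2 * q ^+ 5 + 3 * q ^+ 4 + 3 * q ^+ 3 + 3 * q ^+ 2 + 3 * q + 20).
Proof.
move=> q2 ha hb.
have q_gt0 : 0 < q by lra.
have qX_gt0 k : 0 < q ^+ k by rewrite exprn_gt0.
have tE (m k : nat) : (m + 6 = 2 * u + k)%N -> q ^+ m = q ^ (2 * u%:Z - 6) * q ^+ k.
  (* Factoring out [q ^ (2 * u%:Z - 6)], whose exponent may be negative, treats all [u]
     uniformly. *)
  by move=> mk; rewrite !exprnP -expfzDr ?gt_eqF //; congr (_ ^ _); lia.
move: (q ^ _) (exprz_gt0 (2 * u%:Z - 6) q_gt0) tE => t t0 tE.
have uE : q ^+ u * q ^+ u = t * q ^+ 6 by rewrite -exprD; apply: tE; lia.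
have k4 : (q ^+ (u - 4) - 1) * q ^+ u <= t * q ^+ 2.
  have [u4 | u4] := ltnP u 4.
    (* For small [u] the truncated subtraction gives exponent 0, so the term vanishes. *)
    have -> : (u - 4 = 0)%N by apply/eqP; rewrite subn_eq0 ltnW.
    by rewrite expr0 subrr mul0r; apply/ltW/mulr_gt0/qX_gt0.
  have <- : q ^+ (u - 4 + u) = t * q ^+ 2 by apply: tE; lia.
  by rewrite exprD ler_pM2r ?qX_gt0 // gerBl ler01.
have k2 : (q ^+ (u - 2) - 1) * q ^+ (u - 1) <= t * q ^+ 3.
  have [u2 | u2] := ltnP u 2.
    have -> : (u - 2 = 0)%N by apply/eqP; rewrite subn_eq0 ltnW.
    by rewrite expr0 subrr mul0r; apply/ltW/mulr_gt0/qX_gt0.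
  have <- : q ^+ (u - 2 + (u - 1)) = t * q ^+ 3 by apply: tE; lia.
  by rewrite exprD ler_pM2r ?qX_gt0 // gerBl ler01.
have a_le : a <= t * (q ^+ 8 + q ^+ 6).
  have pos : 0 < q ^+ 2 - 1 by rewrite subr_gt0 exprn_egt1 //; lra.
  rewrite -(ler_pM2r pos); apply: le_trans ha _; rewrite -mulrA uE.
  by rewrite le_eqVlt; apply/orP; left; apply/eqP; ring.
(* The coefficients up to [3 * q] begin the expansion of [q^5 (q^2 + q + 1) / (q - 1)]. The constant
   20 absorbs its tail and the two lower-order terms for all [q >= 2]. *)
have b_le : b <= t * (q ^+ 6 + 2 * q ^+ 5 + 3 * q ^+ 4 + 3 * q ^+ 3
    + 3 * q ^+ 2 + 3 * q + 20).
  have hb' : b * ((q - 1) ^+ 2 * q) <=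
      t * q ^+ 6 * (q ^+ 3 - 1) + t * q ^+ 2 + t * q ^+ 3.
    apply: le_trans hb _; apply: lerD k2; apply: lerD k4.
    rewrite -uE mulrAC; apply: ler_wpM2r.
      by rewrite subr_ge0 exprn_ege1 //; lra.
    by rewrite ler_pM2r ?qX_gt0 // gerBl ler01.
  have pos : 0 < (q - 1) ^+ 2 * q by rewrite mulr_gt0 ?exprn_gt0 //; lra.
  rewrite -(ler_pM2r pos); apply: le_trans hb' _; rewrite -subr_ge0.
  (* Expanding around [q = 2] makes every coefficient of the difference positive. *)
  rewrite [X in 0 <= X](_ : _ = t * (q * (16 * (q - 2) ^+ 2 + 26 * (q - 2) + 8))); last by ring.
  have r0 : 0 <= q - 2 by rewrite subr_ge0.
  apply/mulr_ge0/mulr_ge0; [exact: ltW | exact: ltW | by nra].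
apply: le_trans (lerD a_le b_le) _.
by rewrite -mulrDr ler_pM2l //; lra.
Qed.

Lemma f21_bound (F : finFieldType) (u : nat) (q := #|F|%:R : rat) :
  (f21 F u.+3)%:R <= q ^ (2 * u%:Z - 6) *
    (q ^+ 8 + 2 * q ^+ 6 + 2 * q ^+ 5 + 3 * q ^+ 4 + 3 * q ^+ 3 + 3 * q ^+ 2 + 3 * q + 20).
Proof.
have [a [b [fab ha hb]]] := f21_construction F u.
have F1 : (1 < #|F|)%N := card_finNzRing_gt1 F.
have predE k : (#|F| ^ k).-1%:R = q ^+ k - 1 :> rat.
  by rewrite -subn1 natrB ?expn_gt0 ?(ltnW F1) // natrX.
have pred1E : #|F|.-1%:R = q - 1 :> rat by rewrite -[#|F|]expn1 predE expr1.
apply: (@le_trans _ _ (a%:R + b%:R)); first by rewrite -natrD ler_nat.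
apply: construction_bound; first by rewrite ler_nat.
  by move: ha; rewrite -(ler_nat rat) !natrM !predE !natrX.
by move: hb; rewrite -(ler_nat rat) !(natrD, natrM) !predE !natrX pred1E.
Qed.

Theorem theorem1p9 (n : nat) (hn : (2 <= n)%N) :
  exists (C : rat) (q0 : nat),
    forall F : finFieldType, (q0 <= #|F|)%N ->
      let q : rat := (#|F|)%:R in
      ((f21 F n)%:R : rat) <=
        q ^ (2 * n%:Z - 4) + 2 * q ^ (2 * n%:Z - 6) + 2 * q ^ (2 * n%:Z - 7)
        + 3 * q ^ (2 * n%:Z - 8) + 3 * q ^ (2 * n%:Z - 9)
        + 3 * q ^ (2 * n%:Z - 10) + 3 * q ^ (2 * n%:Z - 11)
        + C * q ^ (2 * n%:Z - 12).
Proof.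
(* With [n = u + 3], the factor [q ^ (2 * u%:Z - 6)] is [q ^ (2 * n%:Z - 12)], so 20 is the constant
   term of [f21_bound]. *)
exists 20, 0%N => F _; lazy zeta.
have : 0 < (#|F|%:R : rat) by rewrite ltr0n; apply: ltnW (card_finNzRing_gt1 F).
case: n hn => [|[|[|u]]] // _.
  have := f21_plane F; rewrite -(ler_nat rat); move: (#|F|%:R : rat) => q f_le q0.
  (* For [n = 2] the leading term is already 1 and the others are nonnegative. *)
  apply: le_trans f_le _; rewrite (_ : 2 * 2%:Z - 4 = 0) // expr0z.
  have term_ge0 k m : 0 <= k%:R * q ^ m by apply/(mulr_ge0 (ler0n _ _))/ltW/exprz_gt0.
  rewrite -!addrA lerDl; do 6 (apply: addr_ge0; first exact: term_ge0).
  exact: term_ge0.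
have := f21_bound F u; move: (#|F|%:R : rat) => q f_le q0.
apply: le_trans f_le _.
have tE (m : int) (k : nat) :
    m = 2 * u%:Z - 6 + k%:Z -> q ^ m = q ^ (2 * u%:Z - 6) * q ^+ k.
  by move=> ->; rewrite expfzDr ?gt_eqF.
rewrite (tE (2 * u.+3%:Z - 4) 8%N); last by lia.
rewrite (tE (2 * u.+3%:Z - 6) 6%N); last by lia.
rewrite (tE (2 * u.+3%:Z - 7) 5%N); last by lia.
rewrite (tE (2 * u.+3%:Z - 8) 4%N); last by lia.
rewrite (tE (2 * u.+3%:Z - 9) 3%N); last by lia.
rewrite (tE (2 * u.+3%:Z - 10) 2%N); last by lia.
rewrite (tE (2 * u.+3%:Z - 11) 1%N); last by lia.
rewrite (tE (2 * u.+3%:Z - 12) 0%N); last by lia.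
by rewrite le_eqVlt; apply/orP; left; apply/eqP; ring.
Qed.
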